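(* Let $\mu_m=\dfrac{(aq;q)_m}{(abq^2;q)_m}$ for integers $m\ge 0$. Let $n$ be a positive integer and $t$ a nonnegative integer. Then $$\det\left(\mu_{i+j+t}\right)_{0\le i,j\le n-1}=a^{\frac12 n(n-1)}\,q^{\frac16 n(n-1)(2n-1)+\frac12 n(n-1)t}\left\{\frac{(aq;q)_t}{(abq^2;q)_t}\right\}^{n}\prod_{k=1}^{n}\frac{(q;q)_{n-k}\,(aq^{t+1};q)_{n-k}\,(bq;q)_{n-k}}{(abq^{n-k+t+1};q)_{n-k}\,(abq^{t+2};q)_{2(n-k)}}.$$
   Context: Here $a,b,q$ are indeterminates, and the identity is an identity of rational functions in $a,b,q$. For a nonnegative integer $m$, the $q$-shifted factorial is $(x;q)_m=\prod_{k=0}^{m-1}(1-xq^k)$, with $(x;q)_0=1$. *)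

(* Defs.v *)
From mathcomp Require Import all_boot all_algebra.
From mathcomp Require Import mpoly.
Set Implicit Arguments.
Unset Strict Implicit.
Unset Printing Implicit Defensive.
Import GRing.Theory.
Local Open Scope ring_scope.

Definition ratfun3 (k : fieldType) : fieldType := {fraction {mpoly k[3]}}.

(* a, b, q are the variables X_0, X_1, X_2 of k(X_0, X_1, X_2); the numerals
   passed to indet are elements of the ring 'I_3 (integers mod 3). *)
Definition indet (k : fieldType) (i : 'I_3) : ratfun3 k :=
  FracField.tofrac ('X_i : {mpoly k[3]}).

Definition va (k : fieldType) : ratfun3 k := indet k 0.
Definition vb (k : fieldType) : ratfun3 k := indet k 1.
Definition vq (k : fieldType) : ratfun3 k := indet k 2%:R.

Definition qpoch (R : pzRingType) (x q : R) (m : nat) : R :=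
  \prod_(0 <= k < m) (1 - x * q ^+ k).

Definition mu (F : fieldType) (a b q : F) (m : nat) : F :=
  qpoch (a * q) q m / qpoch (a * b * q ^+ 2) q m.

(* Main.v *)
(* Put A = a q^(t+1) and C = a b q^(t+2).  Pulling (A;q)_i / (C;q)_(i+n-1) out
   of row i leaves the entry (A q^i;q)_j (C q^(i+j);q)_(n-1-j), a polynomial of
   degree n-1 evaluated at x = q^i, so the determinant is a Vandermonde
   determinant times the determinant of the coefficient matrix.  The latter is
   Krattenthaler's: the difference of two consecutive columns is a scalar
   multiple of x times a column of the same shape and of degree n-2. *)
Require Import Defs.
From mathcomp Require Import all_boot all_algebra.
From mathcomp Require Import mpoly.
From mathcomp Require Import ring zify.
Set Implicit Arguments.
Unset Strict Implicit.
Unset Printing Implicit Defensive.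
Import GRing.Theory.
Local Open Scope ring_scope.

(** * Krattenthaler's determinant over a commutative ring *)

Section Krattenthaler.
Variable R : comNzRingType.
Implicit Types a c : nat -> R.

Definition mixed_poly n a c j : {poly R} :=
  \prod_(0 <= k < j) (1 - a k *: 'X) * \prod_(j <= k < n.-1) (1 - c k *: 'X).

Lemma size_prod_linear c (m n : nat) :
  (size (\prod_(m <= k < n) (1 - c k *: 'X))%R <= (n - m).+1)%N.
Proof.
elim: n => [|n IHn]; first by rewrite big_geq // size_polyC oner_eq0.
have [lt_nm | le_mn] := ltnP n m; first by rewrite big_geq // size_polyC oner_eq0.
rewrite big_nat_recr //=.
apply: leq_trans (size_polyMleq _ _) _.
have : (size (1 - c n *: 'X)%R <= 2)%N.
  apply: leq_trans (size_polyD _ _) _.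
  rewrite geq_max size_polyC oner_eq0 size_polyN /=.
  by apply: leq_trans (size_scale_leq _ _) _; rewrite size_polyX.
move: IHn; set u := size _; set v := size _; lia.
Qed.

Lemma size_mixed_poly n a c j : (j < n)%N -> (size (mixed_poly n a c j) <= n)%N.
Proof.
move=> lt_jn; apply: leq_trans (size_polyMleq _ _) _.
have := size_prod_linear c j n.-1; have := size_prod_linear a 0 j.
set u := size _; set v := size _; lia.
Qed.

(** Columns [j] and [j.+1] differ in a single factor, [1 - c j *: 'X] against [1 - a j *: 'X]. Once
    it is removed, index [j] is missing among the [c k], and shifting [c] closes the gap. *)
Lemma mixed_polyB n a c j : (j < n)%N ->
  mixed_poly n.+1 a c j - mixed_poly n.+1 a c j.+1 =
  (a j - c j) *: (mixed_poly n a (fun k => c k.+1) j * 'X).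
Proof.
move=> lt_jn; rewrite /mixed_poly /= big_nat_recr //= (@big_ltn _ _ _ j n) //.
case: n lt_jn => // n _; rewrite big_add1 /= -!mul_polyC polyCB; ring.
Qed.

Lemma coef0_mixed_poly n a c j : (mixed_poly n a c j)`_0 = 1.
Proof.
rewrite -horner_coef0 hornerM !horner_prod !big1 ?mulr1 // => k _;
  by rewrite !hornerE ?mulr0 ?subr0.
Qed.

Lemma det_coef_mixed_poly n a c :
  \det (\matrix_(i < n, j < n) (mixed_poly n a c j)`_i) =
  \prod_(0 <= s < n) \prod_(0 <= j < n.-1 - s) (c (j + s)%N - a j).
Proof.
(* [c] stays general because each reduction shifts it. *)
elim: n c => [|n IHn] c; first by rewrite det_mx00 big_nil.
set K := \matrix_(_, _) _.
(* Right multiplication by the unipotent [N] subtracts column [j.+1] from column [j] and keeps the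
   last column. *)
pose N : 'M[R]_n.+1 := \matrix_(l, j) ((l == j)%:R - (l == j.+1 :> nat)%:R).
have detN : \det N = 1.
  rewrite det_trig.
    by rewrite big1 // => i _; rewrite mxE eqxx (ltn_eqF (ltnSn i)) subr0.
  apply/is_trig_mxP => i j lt_ij; rewrite mxE -val_eqE (ltn_eqF lt_ij).
  by rewrite (ltn_eqF (ltnW _)) ?ltnS ?subr0.
have KN_lt i (j : 'I_n) : (K *m N) i (widen_ord (leqnSn n) j) =
    (a j - c j) * (mixed_poly n a (fun k => c k.+1) j * 'X)`_i.
  rewrite -coefZ -mixed_polyB // mxE coefB.
  rewrite (bigD1 (widen_ord (leqnSn n) j)) //= (bigD1 (lift ord0 j)) /=; last first.
    by rewrite -val_eqE /= /bump /= add1n neq_ltn ltnSn orbT.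
  rewrite big1 => [|l /andP[nl1 nl2]].
    rewrite !mxE -!val_eqE /= /bump /= add1n !eqxx.
    by rewrite (ltn_eqF (ltnSn j)) (gtn_eqF (ltnSn j)) ?subr0 ?sub0r ?mulr1 ?mulrN ?mulr1 ?addr0.
  rewrite !mxE (negPf nl1); move: nl2; rewrite -val_eqE /= /bump /= add1n.
  by move/negPf->; rewrite subr0 mulr0.
have KN_max i : (K *m N) i ord_max = (mixed_poly n.+1 a c n)`_i.
  rewrite mxE (bigD1 ord_max) //= big1 => [|l nl].
    by rewrite !mxE eqxx (ltn_eqF (ltnSn n)) subr0 mulr1 addr0.
  by rewrite !mxE (negPf nl) (ltn_eqF (ltn_ord l)) subr0 mulr0.
have -> : \det K = \det (K *m N) by rewrite det_mulmx detN mulr1.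
(* Row 0 holds the constant coefficients: the differences are multiples of ['X], so only the 1 in
   the last column survives. *)
rewrite (expand_det_row _ ord0) big_ord_recr /= big1 => [|j _]; last first.
  by rewrite KN_lt coefMX eqxx mulr0 mul0r.
rewrite add0r KN_max coef0_mixed_poly mul1r /cofactor add0n.
have -> : row' ord0 (col' ord_max (K *m N)) =
    (\matrix_(i < n, j < n) (mixed_poly n a (fun k => c k.+1) j)`_i)
    *m diag_mx (\row_j (a j - c j)).
  apply/matrixP => i j; rewrite [LHS]mxE [LHS]mxE.
  have -> : lift ord_max j = widen_ord (leqnSn n) j.
    by apply: val_inj; rewrite /= /bump leqNgt ltn_ord.
  by rewrite KN_lt coefMX mul_mx_diag !mxE mulrC.
(* The cofactor sign turns the [a j - c j] into [c j - a j], which is the factor [s = 0]. *)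
rewrite det_mulmx IHn det_diag mulrCA mulrC big_nat_recl //; congr (_ * _).
  rewrite subn0 big_mkord -[X in _ ^+ X]card_ord -prodrN.
  by apply: eq_bigr => j _; rewrite mxE opprB addn0.
apply: eq_bigr => s _; have -> : (n - s.+1 = n.-1 - s)%N by lia.
by apply: eq_bigr => j _; rewrite addnS.
Qed.

Lemma det_mixed_products n a c (x : nat -> R) :
  \det (\matrix_(i < n, j < n)
    (\prod_(0 <= k < j) (1 - a k * x i)
     * \prod_(j <= k < n.-1) (1 - c k * x i))) =
  \prod_(0 <= j < n) \prod_(0 <= i < j) (x j - x i)
  * \prod_(0 <= s < n) \prod_(0 <= j < n.-1 - s) (c (j + s)%N - a j).
Proof.
set M := \matrix_(_, _) _.
have -> : M = (Vandermonde n (\row_i x i))^T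
    *m \matrix_(i < n, j < n) (mixed_poly n a c j)`_i.
  apply/matrixP => i j; rewrite !mxE.
  transitivity (mixed_poly n a c j).[x i].
    by rewrite hornerM !horner_prod; congr (_ * _); apply: eq_bigr => k _;
      rewrite !hornerE.
  rewrite (horner_coef_wide _ (size_mixed_poly _ _ (ltn_ord j))).
  by apply: eq_bigr => l _; rewrite !mxE mulrC.
rewrite det_mulmx det_tr det_Vandermonde det_coef_mixed_poly; congr (_ * _).
rewrite (exchange_big_dep xpredT) //= big_mkord; apply: eq_bigr => j _.
rewrite big_mkord (big_ord_widen _ (fun i => x j - x i) (ltnW (ltn_ord j))).
by apply: eq_bigr => i _; rewrite !mxE.
Qed.

End Krattenthaler.

Lemma qpochD (R : pzRingType) (x q : R) m n :
  qpoch x q (m + n) = qpoch x q m * qpoch (x * q ^+ m) q n.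
Proof.
rewrite /qpoch (big_cat_nat _ (leq_addr n m)) //=; congr (_ * _).
rewrite -[X in \prod_(X <= _ < _) _]add0n big_addn addKn.
by apply: eq_bigr => k _; rewrite addnC exprD mulrA.
Qed.

Lemma prod_nat_exp (R : comPzRingType) (x : R) n : \prod_(0 <= i < n) x = x ^+ n.
Proof. by rewrite prodr_const_nat subn0. Qed.

(** * Hankel determinant of quotients of q-shifted factorials *)

Section Hankel.
Variables (F : fieldType) (A B q : F).

(** The factor gained by the Hankel determinant from order [m] to order [m.+1]. *)
Definition hankel_pivot m : F :=
  A ^+ m * q ^+ (m * m.-1) * qpoch q q m * qpoch A q m * qpoch B q m
  / (qpoch (A * B * q ^+ m.-1) q m * qpoch (A * B) q m.*2).

(* With S n the product of the row denominators, det_hankel amounts to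
   (prod_(i < n) (A;q)_i) / S n * (V n * K n) = prod_(m < n) hankel_pivot m:
   V is the Vandermonde factor at the powers of q and K the coefficient factor. *)
Let V n := \prod_(0 <= j < n) \prod_(0 <= i < j) (q ^+ j - q ^+ i).
Let K n := \prod_(0 <= s < n) \prod_(0 <= j < n.-1 - s)
  (A * B * q ^+ (j + s) - A * q ^+ j).
Let S n := \prod_(0 <= i < n) qpoch (A * B) q (i + n.-1).

(** [V] gains [q^n - q^i] for each [i < n], and row [s] of [K] gains its entry at [j = n-1-s].
    Paired at [i = s] they give [A q^(n-1) (1 - q^(n-i)) (1 - B q^i)], as the two signs cancel. *)
Lemma VK_recr n : V n.+1 * K n.+1 =
  V n * K n * (A ^+ n * q ^+ (n * n.-1) * qpoch q q n * qpoch B q n).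
Proof.
rewrite /V big_nat_recr //=.
have -> : K n.+1 = K n * \prod_(0 <= s < n) (A * q ^+ (n.-1 - s) * (B * q ^+ s - 1)).
  rewrite /K big_nat_recr //= subnn (@big_geq _ _ _ 0 0) // mulr1 -big_split.
  apply: eq_big_nat => s /andP[_ lt_sn]; have -> : (n - s = (n.-1 - s).+1)%N by lia.
  rewrite big_nat_recr //=; congr (_ * _); rewrite exprD; ring.
rewrite mulrACA; congr (_ * _); rewrite -big_split /=.
rewrite [qpoch q q n]big_nat_rev mulnC exprM -(prod_nat_exp A) -(prod_nat_exp (q ^+ _)) -!big_split /=.
apply: eq_big_nat => i /andP[_ lt_in]; rewrite add0n.
have -> : n = (i + (n - i.+1)).+1 by lia.
move: (n - i.+1)%N => r; rewrite /= subSS addKn. rewrite exprS exprD; ring.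
Qed.

Hypothesis C_neq0 : forall k, 1 - A * B * q ^+ k != 0.

Lemma qpoch_neq0 k m : qpoch (A * B * q ^+ k) q m != 0.
Proof.
by rewrite prodf_seq_neq0; apply/allP => i _ /=; rewrite -(mulrA (A * B)) -exprD.
Qed.

(** With C = AB, the lengths n..2n become n+1..2n+2: length n is lost, 2n+1 and 2n+2 are gained, and
    (C;q)_(2n+1) = (C;q)_n (C q^n;q)_(n+1). *)
Lemma S_recr n :
  S n.+2 = S n.+1 * (qpoch (A * B * q ^+ n) q n.+1 * qpoch (A * B) q n.+1.*2).
Proof.
rewrite /S [LHS]big_nat_recr // [in LHS]big_nat_recr // big_nat_recl //= add0n mulrA.
rewrite addnn qpochD (eq_bigr (fun i => qpoch (A * B) q (i.+1 + n))) => [|i _].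
  by ring.
by rewrite addnS.
Qed.

Lemma det_hankel n :
  \det (\matrix_(i < n, j < n) (qpoch A q (i + j) / qpoch (A * B) q (i + j))) =
  \prod_(0 <= m < n) hankel_pivot m.
Proof.
have C0 m : qpoch (A * B) q m != 0.
  by have := qpoch_neq0 0 m; rewrite expr0 mulr1.
transitivity (\prod_(0 <= i < n) qpoch A q i / S n * (V n * K n)).
  rewrite -(det_mixed_products n (fun k => A * q ^+ k) (fun k => A * B * q ^+ k) (fun i => q ^+ i)) -prodf_div.
  set M := (X in _ = _ * \det X).
  rewrite [X in _ = X * _]big_mkord.
  transitivity (\det (diag_mx (\row_(i < n) (qpoch A q i / qpoch (A * B) q (i + n.-1))) *m M)).
    congr (\det _); apply/matrixP => i j; rewrite mul_diag_mx /M !mxE /=.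
    have -> : \prod_(j <= k < n.-1) (1 - A * B * q ^+ k * q ^+ i) =
        qpoch (A * B * q ^+ (i + j)) q (n.-1 - j).
      rewrite -[X in \prod_(X <= _ < _) _]add0n big_addn.
      by apply: eq_bigr => k _; rewrite -!mulrA -!exprD; congr (1 - A * (B * q ^+ _)); lia.
    have -> : \prod_(0 <= k < j) (1 - A * q ^+ k * q ^+ i) = qpoch (A * q ^+ i) q j.
      by apply: eq_bigr => k _; rewrite mulrAC.
    have -> : (i + n.-1 = i + j + (n.-1 - j))%N by have := ltn_ord j; lia.
    rewrite !qpochD; field.
    by rewrite C0 !qpoch_neq0.
  rewrite det_mulmx det_diag; congr (_ * _).
  by apply: eq_bigr => i _; rewrite mxE.
(* Order 0 is treated apart, since [S_recr] starts from order 1. *)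
case: n => [|n].
  by rewrite /S /V /K !big_nil mulr1 divr1 mulr1.
elim: n => [|n IHn].
  rewrite /S /V /K !big_nat1 /hankel_pivot /qpoch !big_geq //.
  by rewrite !(expr0, mulr1, divr1).
rewrite [RHS]big_nat_recr // -IHn VK_recr [\prod_(0 <= i < n.+2) _]big_nat_recr //.
rewrite S_recr /hankel_pivot /=; field.
rewrite C0 qpoch_neq0 prodf_seq_neq0; apply/allP => i _ /=; exact: C0.
Qed.

End Hankel.

(** * Exponents, and specialization to [mu] *)

Lemma sum_squares n :
  (\sum_(0 <= m < n) m * m = (n * (n - 1) * (2 * n - 1)) %/ 6)%N.
Proof.
have H : (6 * \sum_(0 <= m < n) m * m = n * (n - 1) * (2 * n - 1))%N.
  elim: n => [|n IHn]; first by rewrite big_nil.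
  rewrite big_nat_recr //= mulnDr IHn; case: n {IHn} => [|n] //.
  have D m : (2 * m.+1 - 1 = 2 * m + 1)%N by lia.
  rewrite !D !subn1 /=; ring.
by rewrite -H mulKn.
Qed.

Lemma det_mu (F : fieldType) (a b q : F) (n t : nat) :
  (forall k, 1 - a * b * q ^+ k.+2 != 0) ->
  \det (\matrix_(i < n, j < n) mu a b q (i + j + t)) =
    a ^+ ((n * (n - 1)) %/ 2)
    * q ^+ ((n * (n - 1) * (2 * n - 1)) %/ 6 + (n * (n - 1)) %/ 2 * t)
    * (qpoch (a * q) q t / qpoch (a * b * q ^+ 2) q t) ^+ n
    * \prod_(1 <= l < n.+1)
        (qpoch q q (n - l) * qpoch (a * q ^+ (t + 1)) q (n - l)
           * qpoch (b * q) q (n - l)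
         / (qpoch (a * b * q ^+ (n - l + t + 1)) q (n - l)
            * qpoch (a * b * q ^+ (t + 2)) q (2 * (n - l)))).
Proof.
move=> ab_neq0; set A := a * q ^+ (t + 1); set r := _ / _.
have AB : A * (b * q) = a * b * q ^+ (t + 2) by rewrite /A !exprD; ring.
have AB_neq0 k : 1 - A * (b * q) * q ^+ k != 0.
  by rewrite AB -(mulrA (a * b)) -exprD addnAC addn2.
(* The first [t] factors above and below are common to all entries and form [r]. *)
have -> : \matrix_(i < n, j < n) mu a b q (i + j + t) = r *:
    \matrix_(i < n, j < n) (qpoch A q (i + j) / qpoch (A * (b * q)) q (i + j)).
  apply/matrixP => i j; rewrite !mxE /mu addnC !qpochD /r mulf_div AB.
  have -> : a * q * q ^+ t = A by rewrite /A exprD; ring.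
  by rewrite -(mulrA (a * b)) -exprD addnC.
rewrite detZ det_hankel // -sum_squares.
(* With the exponents written as sums over [m], the powers spread over the product, whose factor [m]
   is matched with [l = n - m]. *)
have -> : ((n * (n - 1)) %/ 2 = \sum_(0 <= m < n) m)%N.
  by rewrite bin2_sum bin2 divn2 subn1.
rewrite big_distrl -big_split /= -!prodrXr mulrAC mulrC; congr (_ * _).
rewrite big_add1 [X in _ = _ * X]big_nat_rev -!big_split.
apply: eq_big_nat => m /andP[_ lt_mn] /=.
have -> : (n - (0 + n - m.+1).+1 = m)%N by lia.
rewrite /hankel_pivot AB mul2n -/A.
have -> : qpoch (a * b * q ^+ (t + 2) * q ^+ m.-1) q m =
    qpoch (a * b * q ^+ (m + t + 1)) q m.
  (* At [m = 0] the truncated [m.-1] makes the two bases differ, but both products are empty. *)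
  case: m {lt_mn} => [|m]; first by rewrite /qpoch !big_geq.
  by rewrite -(mulrA (a * b)) -exprD; congr (qpoch (a * b * q ^+ _) q _); lia.
have -> : A ^+ m * q ^+ (m * m.-1) = a ^+ m * q ^+ (m * m + m * t).
  rewrite exprMn -exprM -mulrA -exprD; congr (_ * q ^+ _).
  by case: m {lt_mn} => [|m] /=; lia.
by rewrite !mulrA.
Qed.

Theorem corollary1p2 (k : fieldType) (n t : nat) (hn : (0 < n)%N) :
  let a : ratfun3 k := va k in
  let b : ratfun3 k := vb k in
  let q : ratfun3 k := vq k in
  \det (\matrix_(i < n, j < n) mu a b q (i + j + t)) =
    a ^+ ((n * (n - 1)) %/ 2)
    * q ^+ ((n * (n - 1) * (2 * n - 1)) %/ 6 + (n * (n - 1)) %/ 2 * t)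
    * (qpoch (a * q) q t / qpoch (a * b * q ^+ 2) q t) ^+ n
    * \prod_(1 <= l < n.+1)
        (qpoch q q (n - l) * qpoch (a * q ^+ (t + 1)) q (n - l)
           * qpoch (b * q) q (n - l)
         / (qpoch (a * b * q ^+ (n - l + t + 1)) q (n - l)
            * qpoch (a * b * q ^+ (t + 2)) q (2 * (n - l)))).
Proof.
move=> a b q; apply: det_mu => m.
rewrite /a /b /q /va /vb /vq /indet.
rewrite -tofracXn -!tofracM -tofrac1 -tofracB tofrac_eq0.
(* The denominator factor is a polynomial with value 1 at the origin, hence nonzero. *)
apply: contraTneq isT => /(congr1 (meval (fun _ => 0))).
rewrite mevalB !mevalM meval1 meval0 mevalXU !mul0r subr0 => /eqP.
by rewrite oner_eq0.
Qed.
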